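(* Let $\mathcal{I}=[0,\bar z]$ with $\bar z>0$, let $T>0$, and let $f_0\in L^\infty(\mathcal{I})$ be a probability density, i.e. $f_0\ge 0$ and $\int_{\mathcal{I}}f_0(z)\,dz=1$. Let $\alpha=\alpha(z,t)\in L^\infty([0,T];L^1(\mathcal{I}))$ be a given learning function with values in $[0,1]$. Then the equation $$\partial_t f(z,t)=-\alpha(z,t)f(z,t)\int_z^{\bar z}f(y,t)\,dy+f(z,t)\int_0^z\alpha(y,t)f(y,t)\,dy,\qquad f(z,0)=f_0(z),$$ has a global in time solution $f\in L^\infty([0,T];L^1(\mathcal{I}))$, i.e. a solution on the whole interval $[0,T]$.
   Context: A solution is understood in the time-integrated sense: for almost every $z\in\mathcal{I}$ and all $t\in[0,T]$, $f(z,t)$ equals $f_0(z)$ plus the integral over $[0,t]$ of the right-hand side. *)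

(* Defs.v *)
From HB Require Import structures.
From mathcomp Require Import all_boot all_order all_algebra.
From mathcomp Require Import all_classical all_reals all_analysis.

Set Implicit Arguments.
Unset Strict Implicit.
Unset Printing Implicit Defensive.

Import Order.TTheory GRing.Theory Num.Theory.
Import numFieldNormedType.Exports.

Local Open Scope classical_set_scope.
Local Open Scope ring_scope.

Notation mu := lebesgue_measure.

(* Functions on a subset D of R are represented by functions on R whose values
   outside D are ignored: norms and memberships are those of the extension by
   zero [f \_ D]. *)
Definition in_Lp (R : realType) (p : \bar R) (D : set R) (f : R -> R) : Prop :=
  f \_ D \in Lfun mu p.

Definition norm_Lp (R : realType) (p : \bar R) (D : set R) (f : R -> R) :
    \bar R :=
  ('N[mu]_p[EFin \o (f \_ D)])%E.

(* Bochner spaces. A function J -> L^1(I) is represented by f : R -> R -> R,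
   where f z t is the value at z in I of the element f(., t) of L^1(I). *)

Definition simple_L1 (R : realType) (I J : set R) (s : R -> R -> R) : Prop :=
  exists (n : nat) (A : 'I_n -> set R) (g : 'I_n -> R -> R),
    [/\ forall i, measurable (A i) /\ A i `<=` J,
        forall i, in_Lp 1%E I (g i)
      & forall z t, s z t = \sum_(i < n) \1_(A i) t * g i z].

Definition strongly_measurable_L1 (R : realType) (I J : set R)
    (f : R -> R -> R) : Prop :=
  exists s : nat -> R -> R -> R,
    (forall n, simple_L1 I J (s n)) /\
    {ae mu, forall t, J t ->
      norm_Lp 1%E I (fun z => f z t - s n z t) @[n --> \oo] --> 0%E}.

(* Joint measurability singles out representatives of the elements of
   L^oo(J; L^1(I)) that are genuine functions of (z, t); every element has such
   a representative, and time integrals at fixed z are meaningless without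
   it. *)
Definition Linfty_L1 (R : realType) (I J : set R) (f : R -> R -> R) : Prop :=
  [/\ measurable_fun (I `*` J) (fun p : R * R => f p.1 p.2),
      {ae mu, forall t, J t -> in_Lp 1%E I (f^~ t)},
      strongly_measurable_L1 I J f
    & ('N[mu]_+oo[(fun t => norm_Lp 1%E I (f^~ t)) \_ J] < +oo)%E].

Definition rhs (R : realType) (zbar : R) (alpha f : R -> R -> R) (z t : R) : R :=
  - alpha z t * f z t * (\int[mu]_(y in `[z, zbar]) f y t)
  + f z t * (\int[mu]_(y in `[0, z]) (alpha y t * f y t)).

(* [\int] is total on non-integrable functions, hence the explicit
   integrability of the right-hand side in time. *)
Definition is_solution (R : realType) (zbar T : R) (alpha : R -> R -> R)
    (f0 : R -> R) (f : R -> R -> R) : Prop :=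
  {ae mu, forall z : R, z \in `[0, zbar] ->
    mu.-integrable `[0, T] (EFin \o rhs zbar alpha f z) /\
    forall t : R, t \in `[0, T] ->
      f z t = f0 z + \int[mu]_(s in `[0, t]) rhs zbar alpha f z s}.

(* Main.v *)
Require Import Defs.
From HB Require Import structures.
From mathcomp Require Import all_boot all_order all_algebra.
From mathcomp Require Import all_classical all_reals all_analysis.
From mathcomp Require Import measurable_realfun ess_sup_inf ring lra.

Set Implicit Arguments.
Unset Strict Implicit.
Unset Printing Implicit Defensive.

Import Order.TTheory GRing.Theory Num.Theory.
Import numFieldNormedType.Exports.

Local Open Scope classical_set_scope.
Local Open Scope ring_scope.

(** Why a solution exists on all of [[0, T]].

    With the kernel k(z,y,t) = 1_{y <= z} a(y,t) - 1_{z <= y} a(z,t), where a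
    is the learning function, the equation takes the replicator form
        d/dt f(z,t) = f(z,t) w(z,t),   w(z,t) = int k(z,y,t) f(y,t) dy,
    and k is antisymmetric in (z,y). A solution with growth rate w is
    f(z,t) = f_0(z) exp (int_0^t w(z,s) ds), so that nonnegativity holds by
    construction and only w has to be found, as a fixed point.

    The map sending w to int k f involves the exponential of w, hence is not
    Lipschitz globally. Dividing it by the mass of f at time t repairs this:
    the result is an average of k, so it is bounded by 1, and it depends on the
    time integral of w through a softmax, which is Lipschitz for the sup
    distance with an absolute constant. In the distance weighted by exp (8 |t|)
    the normalised map is therefore a contraction ([payoff_contraction]) and
    Picard iteration converges to a fixed point w that is jointly measurable
    ([payoff_fixpoint]).

    The normalisation is then harmless: the derivative of the mass is the mean
    of the payoff, a double integral of an antisymmetric function, so it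
    vanishes ([mean_payoff0]) and the mass stays equal to 1 ([mass_conserved]).
    The fixed point of the normalised map solves the original equation
    ([replicator_equation]), for all t >= 0 at once.

    Two points need care. The rate w is only measurable in time, so the
    integrated equation for f is not an instance of the chain rule for smooth
    functions; [expR_primitive] derives it from a second-order error bound. And
    a takes its values in [[0, 1]] only almost everywhere: the kernel is built
    from a truncation of a, and Fubini's theorem shows that for almost every z
    the truncation changes the right-hand side at a negligible set of times
    only. *)

(** * Integrals with parameters, and almost everywhere equality *)

(** The extended integrals of the positive and of the negative part are measurable
    in the parameter by Tonelli's theorem, even where they are infinite. *)
Lemma measurable_param_Rintegral d1 d2 (X : measurableType d1)
    (Y : measurableType d2) (R : realType)
    (m : {sigma_finite_measure set Y -> \bar R}) (h : X -> Y -> R) :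
  measurable_fun setT (fun p : X * Y => h p.1 p.2) ->
  measurable_fun setT (fun x => \int[m]_y h x y).
Proof.
move=> mh; pose H : X * Y -> \bar R := EFin \o (fun p => h p.1 p.2).
have mH : measurable_fun setT H by exact/measurable_EFinP.
have -> : (fun x => \int[m]_y h x y) =
    (fun x => fine (fubini_F m (H^\+)%E x - fubini_F m (H^\-)%E x)).
  apply/funext => x; rewrite /Rintegral integralE /fubini_F.
  by congr (fine (_ - _)); apply: eq_integral => y _; rewrite !(funeposE, funenegE).
apply: measurableT_comp; first exact: fine_measurable.
apply: emeasurable_funB; apply: measurable_fun_fubini_tonelli_F => //.
  exact: measurable_funepos.
exact: measurable_funeneg.
Qed.

Lemma integrable_le d (X : measurableType d) (R : realType)
    (m : {measure set X -> \bar R}) (D : set X) (f g : X -> R) :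
  measurable D -> measurable_fun D f -> m.-integrable D (EFin \o g) ->
  (forall x, D x -> `|f x| <= g x) -> m.-integrable D (EFin \o f).
Proof.
move=> mD mf ig fg; apply: le_integrable ig => //.
  exact/measurable_EFinP.
by move=> x Dx /=; rewrite lee_fin (le_trans (fg x Dx))// ler_norm.
Qed.

(** Domination by a product of integrable functions makes every section
    integrable, so that the inner real integrals agree with the extended ones
    everywhere and not just almost everywhere. *)
Lemma Rintegral_swap d1 d2 (X : measurableType d1) (Y : measurableType d2)
    (R : realType) (m1 : {sigma_finite_measure set X -> \bar R})
    (m2 : {sigma_finite_measure set Y -> \bar R})
    (h : X -> Y -> R) (a : X -> R) (b : Y -> R) :
  measurable_fun setT (fun p : X * Y => h p.1 p.2) ->
  m1.-integrable setT (EFin \o a) -> m2.-integrable setT (EFin \o b) ->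
  (forall x y, `|h x y| <= a x * b y) ->
  \int[m1]_x \int[m2]_y h x y = \int[m2]_y \int[m1]_x h x y.
Proof.
move=> mh ia ib hab; pose H : X * Y -> \bar R := EFin \o (fun p => h p.1 p.2).
have ih1 x : m2.-integrable setT (EFin \o h x).
  apply: (@integrable_le _ _ _ _ _ _ (fun y => a x * b y)) => //.
    exact: (measurableT_comp mh (pair1_measurable x)).
  exact: (integrableZl measurableT (a x) ib).
have ih2 y : m1.-integrable setT (EFin \o h^~ y).
  apply: (@integrable_le _ _ _ _ _ _ (fun x => b y * a x)) => //.
  - exact: (measurableT_comp mh (pair2_measurable y)).
  - exact: (integrableZl measurableT (b y) ia).
  - by move=> x _; rewrite mulrC.
have inb := integrable_norm ib.
have ih : (m1 \x m2)%E.-integrable setT H.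
  apply/integrable12ltyP; first exact/measurable_EFinP.
  have -> : (fun x => \int[m2]_y `|H (x, y)|)%E =
            EFin \o (fun x => \int[m2]_y `|h x y|).
    apply/funext => x /=; rewrite /Rintegral fineK//.
    by apply: integrable_fin_num => //; exact: (integrable_norm (ih1 x)).
  apply: integrable_lty => //.
  apply: (@integrable_le _ _ _ _ _ _ (fun x => (\int[m2]_y `|b y|) * `|a x|)) => //.
  - apply: (@measurable_param_Rintegral _ _ _ _ _ _ (fun x y => `|h x y|)).
    exact: measurableT_comp.
  - exact: (integrableZl measurableT _ (integrable_norm ia)).
  move=> x _.
  rewrite ger0_norm; last by apply: Rintegral_ge0.
  rewrite mulrC -RintegralZl//.
  apply: le_Rintegral => //.
  - exact: (integrable_norm (ih1 x)).
  - exact: (integrableZl measurableT (`|a x|) inb).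
  - by move=> y _; rewrite (le_trans (hab x y))// -normrM ler_norm.
have := Fubini ih; rewrite /H /= => F.
rewrite [LHS]/Rintegral [RHS]/Rintegral.
have e1 x : (\int[m2]_y h x y)%:E = (\int[m2]_y (h x y)%:E)%E.
  by rewrite /Rintegral fineK//; exact: (integrable_fin_num measurableT (ih1 x)).
have e2 y : (\int[m1]_x h x y)%:E = (\int[m1]_x (h x y)%:E)%E.
  by rewrite /Rintegral fineK//; exact: (integrable_fin_num measurableT (ih2 y)).
under eq_integral do rewrite e1.
under [in RHS]eq_integral do rewrite e2.
by rewrite F.
Qed.

Lemma measurable_param_Rintegral_in d1 d2 (X : measurableType d1)
    (Y : measurableType d2) (R : realType)
    (m : {sigma_finite_measure set Y -> \bar R}) (D : set Y) (h : X -> Y -> R) :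
  measurable D ->
  measurable_fun setT (fun p : X * Y => h p.1 p.2) ->
  measurable_fun setT (fun x => \int[m]_(y in D) h x y).
Proof.
move=> mD mh.
rewrite (_ : (fun x => _) = fun x => \int[m]_y (h x \_ D) y); last first.
  by apply/funext => x; rewrite Rintegral_mkcond.
apply: (@measurable_param_Rintegral _ _ _ _ _ m (fun x => h x \_ D)).
rewrite (_ : (fun p => _) = (fun p : X * Y => h p.1 p.2) \_ (setT `*` D)).
  have mXD : measurable ([set: X] `*` D) by exact: measurableX.
  by apply/(measurable_restrictT _ mXD)/measurable_funTS.
by apply/funext => p; rewrite !patchE in_setX in_setT.
Qed.

(** Both iterated integrals of the measure of the sections of a null set vanish. *)
Lemma ae_prod_sections d1 d2 (X : measurableType d1) (Y : measurableType d2)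
    (R : realType) (m1 : {sigma_finite_measure set X -> \bar R})
    (m2 : {sigma_finite_measure set Y -> \bar R}) (P : X -> Y -> Prop) :
  {ae (m1 \x m2)%E, forall p : X * Y, P p.1 p.2} ->
  {ae m1, forall x, {ae m2, forall y, P x y}} /\
  {ae m2, forall y, {ae m1, forall x, P x y}}.
Proof.
move=> [N [mN N0 PN]].
have N0' : (m1 \x^ m2)%E N = 0%E.
  by rewrite -(product_measure_unique (m1 := m1) (m2 := m2) (m' := (m1 \x^ m2)%E))//;
    move=> A B mA mB; exact: product_measure2E.
split.
  have /(ae_eq_integral_abs m1 measurableT (measurable_fun_xsection m2 mN)) :
      (\int[m1]_x `|(m2 \o xsection N) x| = 0)%E.
    by under eq_integral do rewrite gee0_abs//.
  apply: filterS => x /(_ I)/= x0; exists (xsection N x); split => //.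
    exact: measurable_xsection.
  by move=> y /= nP; rewrite /xsection /=; apply/mem_set; exact: PN.
have /(ae_eq_integral_abs m2 measurableT (measurable_fun_ysection m1 mN)) :
    (\int[m2]_y `|(m1 \o ysection N) y| = 0)%E.
  by under eq_integral do rewrite gee0_abs//.
apply: filterS => y /(_ I)/= y0; exists (ysection N y); split => //.
  exact: measurable_ysection.
by move=> x /= nP; rewrite /ysection /=; apply/mem_set; exact: PN.
Qed.

Lemma ae_imply d (X : measurableType d) (R : realType)
    (m : {measure set X -> \bar R}) (P Q : X -> Prop) :
  (forall x, P x -> Q x) -> {ae m, forall x, P x} -> {ae m, forall x, Q x}.
Proof. by move=> PQ; apply: filterS. Qed.

Lemma ae_imply2 d (X : measurableType d) (R : realType)
    (m : {measure set X -> \bar R}) (P Q S : X -> Prop) :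
  (forall x, P x -> Q x -> S x) -> {ae m, forall x, P x} ->
  {ae m, forall x, Q x} -> {ae m, forall x, S x}.
Proof. by move=> PQS; apply: filterS2. Qed.

Lemma Rintegral_ae_eq d (X : measurableType d) (R : realType)
    (m : {measure set X -> \bar R}) (D : set X) (f g : X -> R) :
  measurable D -> measurable_fun D f -> measurable_fun D g ->
  {ae m, forall x, D x -> f x = g x} ->
  \int[m]_(x in D) f x = \int[m]_(x in D) g x.
Proof.
move=> mD mf mg fg; congr fine; apply: ae_eq_integral => //.
- exact/measurable_EFinP.
- exact/measurable_EFinP.
- by apply: filterS fg => x fgx /fgx ->.
Qed.

Lemma integrable_ae_eq d (X : measurableType d) (R : realType)
    (m : {measure set X -> \bar R}) (D : set X) (f g : X -> R) :
  measurable D -> measurable_fun D f -> m.-integrable D (EFin \o g) ->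
  {ae m, forall x, D x -> f x = g x} -> m.-integrable D (EFin \o f).
Proof.
move=> mD mf ig fg; have mg := measurable_int m ig.
apply/integrableP; split; first exact/measurable_EFinP.
rewrite (@ae_eq_integral _ _ _ m D (abse \o (EFin \o g)))//.
- by case/integrableP : ig.
- by apply: measurableT_comp => //; exact/measurable_EFinP.
- exact: measurableT_comp.
- by apply: filterS fg => x fgx /fgx /= ->.
Qed.

(** * Exponentials of time integrals *)

(** Cutting [[0, T]] into n equal pieces bounds |D T - D 0| by
    |C| T ^ 2 / n. *)
Lemma quadratic_modulus_cst (R : realType) (D : R -> R) (C T : R) : 0 <= T ->
  (forall s t, 0 <= s -> s <= t -> t <= T -> `|D t - D s| <= C * (t - s) ^+ 2) ->
  D T = D 0.
Proof.
move=> T0 DC; apply/eqP; rewrite -subr_eq0 -normr_le0.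
apply/ler_addgt0Pl => e e0; rewrite addr0.
pose A := `|C| * T ^+ 2.
(* n pieces leave an error A / n, which has to be below e. *)
have [n nA] : exists n : nat, A / e < n.+1%:R.
  exists (Num.truncn (A / e)); exact: truncnS_gt.
have n0 : 0 < n.+1%:R :> R by [].
pose x (i : nat) : R := T * i%:R / n.+1%:R.
have x0 : x 0%N = 0 by rewrite /x mulr0 mul0r.
have xn : x n.+1 = T by rewrite /x mulfK.
have xS i : x i.+1 - x i = T / n.+1%:R.
  by rewrite /x -mulrBl -mulrBr -natrB// subSnn mulr1.
have -> : D T - D 0 = \sum_(0 <= i < n.+1) (D (x i.+1) - D (x i)).
  by rewrite telescope_sumr// xn x0.
rewrite (le_trans (ler_norm_sum _ _ _))//.
apply: (@le_trans _ _ (\sum_(0 <= i < n.+1) (`|C| * (T / n.+1%:R) ^+ 2))).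
  rewrite big_nat [leRHS]big_nat; apply: ler_sum => i /andP[_ iN].
  rewrite -(xS i); apply: le_trans (DC (x i) (x i.+1) _ _ _) _.
  - by rewrite /x divr_ge0// mulr_ge0.
  - by rewrite -subr_ge0 xS divr_ge0.
  - by rewrite -xn /x ler_pM2r ?invr_gt0// ler_wpM2l// ler_nat.
  - by rewrite ler_wpM2r ?sqr_ge0 ?ler_norm.
rewrite sumr_const_nat subn0 -[_ *+ _]mulr_natl exprMn exprVn.
have -> : n.+1%:R * (`|C| * (T ^+ 2 * (n.+1%:R ^+ 2)^-1)) = A / n.+1%:R :> R.
  by rewrite /A; move: n0; move: (n.+1%:R) => N N0; field; rewrite gt_eqF.
by rewrite ler_pdivrMr// mulrC -ler_pdivrMr// ltW.
Qed.

Lemma dist_expR (R : realType) (a b : R) :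
  `|expR a - expR b| <= `|a - b| * (expR a + expR b).
Proof.
wlog ba : a b / b <= a.
  move=> H; case: (leP b a) => [/H//|/ltW/H].
  by rewrite distrC [`|b - a|]distrC [expR b + _]addrC.
have eba : expR b <= expR a by rewrite ler_expR.
rewrite !ger0_norm ?subr_ge0//.
have := expR_ge1Dx (b - a); rewrite expRB.
have e0 := expR_gt0 a; have f0 := expR_gt0 b.
rewrite ler_pdivlMr// => H.
have : 0 <= (a - b) * expR b by rewrite mulr_ge0 ?subr_ge0 ?expR_ge0.
nra.
Qed.

(** Convexity of exp makes the remainder nonnegative and bounds it by
    (a - b) (exp a - exp b). *)
Lemma expR_second_order (R : realType) (a b : R) :
  `|expR a - expR b - expR b * (a - b)| <= (a - b) ^+ 2 * (expR a + expR b).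
Proof.
have lo : 0 <= expR a - expR b - expR b * (a - b).
  have := expR_ge1Dx (a - b); rewrite expRB ler_pdivlMr ?expR_gt0// => H; nra.
rewrite ger0_norm//.
have : expR a - expR b - expR b * (a - b) <= (a - b) * (expR a - expR b).
  have := expR_ge1Dx (b - a); rewrite expRB ler_pdivlMr ?expR_gt0// => H; nra.
move=> /le_trans; apply; rewrite (le_trans (ler_norm _))// normrM.
rewrite -[leRHS]ger0_norm; last by rewrite mulr_ge0 ?sqr_ge0// addr_ge0 ?expR_ge0.
rewrite normrM normrX expr2 -mulrA ler_wpM2l// (le_trans (dist_expR _ _))//.
by rewrite ler_wpM2l// ler_norm.
Qed.

Section primitive.
Context {R : realType}.
Implicit Types w v : R -> R.

Definition primitive w (t : R) : R := \int[mu]_(s in `[0, t]) w s.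

Lemma primitive0 w t : t <= 0 -> primitive w t = 0.
Proof.
rewrite le_eqVlt => /predU1P[->|t0]; rewrite /primitive.
  by rewrite set_itv1 Rintegral_set1.
by rewrite set_itv_ge ?Rintegral_set0// bnd_simp -ltNge.
Qed.

(** The variable end point of the interval is moved into the integrand, which
    turns the claim into measurability of an integral with parameters. *)
Lemma measurable_primitive d (X : measurableType d) (w : X -> R -> R) :
  measurable_fun setT (fun p : X * R => w p.1 p.2) ->
  measurable_fun setT (fun p : X * R => primitive (w p.1) p.2).
Proof.
move=> mw.
pose h (p : X * R) (s : R) := if (0 <= s) && (s <= p.2) then w p.1 s else 0.
have -> : (fun p : X * R => primitive (w p.1) p.2) = fun p => \int[mu]_s h p s.
  apply/funext => p; rewrite /primitive Rintegral_mkcond.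
  by apply: eq_Rintegral => s _; rewrite patchE mem_setE in_itv.
apply: (@measurable_param_Rintegral _ _ (X * measurableTypeR R)%type
  (measurableTypeR R) R (@lebesgue_measure R) h).
apply: measurable_fun_ifT => //=.
- apply: measurable_and.
    by apply: measurable_fun_ler; [exact: measurable_cst|exact: measurable_snd].
  apply: measurable_fun_ler => //.
  exact: (measurableT_comp measurable_snd measurable_fst).
- have mq : measurable_fun setT (fun q : (X * R) * R => (q.1.1, q.2)).
    apply: measurable_fun_pair; last exact: measurable_snd.
    exact: (measurableT_comp measurable_fst measurable_fst).
  exact: (measurableT_comp mw mq).
Qed.

Lemma measurable_primitive1 w :
  measurable_fun setT w -> measurable_fun setT (primitive w).
Proof.
move=> mw; have := @measurable_primitive _ R (fun _ => w).
move=> /(_ (measurableT_comp mw measurable_snd)) m.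
exact: (measurableT_comp m (pair1_measurable (0 : R))).
Qed.

Lemma integrable_bounded_itv w (B a b : R) (i : interval R) :
  measurable_fun setT w -> (forall s, a <= s <= b -> `|w s| <= B) ->
  [set` i] `<=` `[a, b] -> mu.-integrable [set` i] (EFin \o w).
Proof.
move=> mw wB iab; apply: (@integrable_le _ _ _ _ _ _ (cst B)) => //.
- exact: measurable_funTS.
- suff ic : mu.-integrable `[a, b] (EFin \o cst B) by exact: integrableS ic.
  apply/integrableP; split; first exact/measurable_EFinP.
  rewrite (eq_integral (cst `|B|%:E))// integral_cst//= lebesgue_measure_itv/=.
  by case: ifP => _; rewrite ?mule0 -?EFinB -?EFinM ltry.
- by move=> x /iab /=; rewrite in_itv/=; exact: wB.
Qed.

Lemma norm_Rintegral_itv w (B s t : R) : s <= t ->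
  measurable_fun setT w -> (forall r, s <= r <= t -> `|w r| <= B) ->
  `|\int[mu]_(r in `]s, t]) w r| <= B * (t - s).
Proof.
move=> st mw wB.
have iw : mu.-integrable `]s, t] (EFin \o w).
  by apply: (integrable_bounded_itv mw wB); exact: subset_itv_oc_cc.
have ic : mu.-integrable `]s, t] (EFin \o cst B).
  apply: (@integrable_bounded_itv (cst B) `|B| s t) => //.
  exact: subset_itv_oc_cc.
rewrite (le_trans (le_normr_Rintegral _ iw))//.
have -> : B * (t - s) = \int[mu]_(r in `]s, t]) B.
  rewrite Rintegral_cst//= lebesgue_measure_itv/= lte_fin.
  by move: st; rewrite le_eqVlt => /predU1P[->|->]//; rewrite ltxx subrr.
apply: le_Rintegral => //; first exact: integrable_norm.
by move=> r /=; rewrite in_itv/= => /andP[sr rt]; rewrite wB// rt ltW.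
Qed.

Lemma primitiveB w (B s t : R) : 0 <= s -> s <= t ->
  measurable_fun setT w -> (forall r, 0 <= r <= t -> `|w r| <= B) ->
  primitive w t - primitive w s = \int[mu]_(r in `]s, t]) w r.
Proof.
move=> s0 st mw wB; rewrite /primitive Rintegral_itvB ?bnd_simp//.
exact: (@integrable_bounded_itv _ _ 0 t _ mw wB).
Qed.

Lemma primitive_lipschitz w (B s t : R) : 0 <= s -> s <= t ->
  measurable_fun setT w -> (forall r, 0 <= r <= t -> `|w r| <= B) ->
  `|primitive w t - primitive w s| <= B * (t - s).
Proof.
move=> s0 st mw wB; rewrite (primitiveB s0 st mw wB).
apply: norm_Rintegral_itv => // r /andP[sr rt].
by rewrite wB// rt (le_trans s0).
Qed.

Lemma norm_primitive w (B t : R) : 0 <= t ->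
  measurable_fun setT w -> (forall r, 0 <= r <= t -> `|w r| <= B) ->
  `|primitive w t| <= B * t.
Proof.
move=> t0 mw wB; have := primitive_lipschitz (lexx 0) t0 mw wB.
by rewrite (primitive0 _ (lexx 0)) !subr0.
Qed.

(** The difference D of the two sides has a quadratic modulus of continuity on
    [[0, t]], hence is constant. Over a short interval [[r, s]] it varies by a
    second-order Taylor remainder of exp minus the integral of
    w (exp W - exp W(r)), W the primitive of w, and both are of order
    (s - r) ^ 2 because W is Lipschitz. *)
Lemma expR_primitive w (B t : R) : 0 <= t ->
  measurable_fun setT w -> (forall s, 0 <= s <= t -> `|w s| <= B) ->
  expR (primitive w t) =
  1 + primitive (fun s => w s * expR (primitive w s)) t.
Proof.
move=> t0 mw wB; set v := fun s => w s * expR (primitive w s).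
have B0 : 0 <= B by apply: le_trans (wB 0 _); rewrite ?lexx.
pose E := expR (B * t).
have E0 : 0 <= E by exact: expR_ge0.
have mW : measurable_fun setT (expR \o primitive w).
  apply: measurableT_comp; first exact: measurable_expR.
  exact: measurable_primitive1.
have mv : measurable_fun setT v by exact: measurable_funM.
have wB' r : r <= t -> forall s, 0 <= s <= r -> `|w s| <= B.
  by move=> rt s /andP[s0 sr]; rewrite wB// s0 (le_trans sr).
have WE r : 0 <= r -> r <= t -> expR (primitive w r) <= E.
  move=> r0 rt; rewrite ler_expR (le_trans (ler_norm _))//.
  rewrite (le_trans (norm_primitive r0 mw (wB' r rt)))//.
  by rewrite ler_wpM2l.
have vB r : 0 <= r <= t -> `|v r| <= B * E.
  move=> /andP[r0 rt]; rewrite normrM ler_pM// ?wB ?r0//.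
  by rewrite ger0_norm ?expR_ge0// WE.
apply/eqP; rewrite -subr_eq; apply/eqP.
have -> : 1 = expR (primitive w 0) - primitive v 0.
  by rewrite !primitive0// expR0 subr0.
apply: (@quadratic_modulus_cst _ (fun t => expR (primitive w t) - primitive v t)
  (4 * B ^+ 2 * E)) => // r s r0 rs st.
have s0 := le_trans r0 rs; have rt := le_trans rs st.
have Wrs x : r <= x -> x <= s -> `|primitive w x - primitive w r| <= B * (s - r).
  move=> rx xs; have xt := le_trans xs st.
  rewrite (le_trans (primitive_lipschitz r0 rx mw (wB' _ xt)))//.
  by rewrite ler_wpM2l// lerD2r.
set c := expR (primitive w r).
have c0 : 0 <= c by exact: expR_ge0.
have cE : c <= E by exact: WE.
have sub : `]r, s] `<=` `[0, t].
  move=> x /=; rewrite !in_itv/= => /andP[/ltW rx xs].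
  by rewrite (le_trans r0)//= (le_trans xs).
have iv : mu.-integrable `]r, s] (EFin \o v) := integrable_bounded_itv mv vB sub.
have iw : mu.-integrable `]r, s] (EFin \o w) := integrable_bounded_itv mw wB sub.
have icw : mu.-integrable `]r, s] (EFin \o (fun x => c * w x)).
  exact: (integrableZl _ c iw).
have vB' x : 0 <= x <= s -> `|v x| <= B * E.
  by move=> /andP[x0 xs]; rewrite vB// x0 (le_trans xs).
have -> : expR (primitive w s) - primitive v s - (c - primitive v r) =
  (expR (primitive w s) - c - c * (primitive w s - primitive w r)) -
  \int[mu]_(x in `]r, s]) (v x - c * w x).
  rewrite RintegralB// RintegralZl//.
  rewrite -(primitiveB r0 rs mw (wB' _ st)) -(primitiveB r0 rs mv vB').
  ring.
have d0 : 0 <= s - r by rewrite subr_ge0.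
have Brs : 0 <= B * (s - r) by rewrite mulr_ge0.
rewrite (le_trans (ler_normB _ _))//.
(* The first summand bounds the Taylor remainder, the second one the integral. *)
have -> : 4 * B ^+ 2 * E * (s - r) ^+ 2 =
  (B * (s - r)) ^+ 2 * (E + E) + B * (B * (s - r) * (E + E)) * (s - r) by ring.
apply: lerD.
  rewrite (le_trans (expR_second_order _ _))// ler_pM ?sqr_ge0//.
  - rewrite -real_normK ?num_real// lerXn2r ?nnegrE// Wrs//.
  - by rewrite lerD// WE.
apply: norm_Rintegral_itv => //.
  by apply: measurable_funB => //; exact: measurable_funM.
move=> x /andP[rx xs]; have x0 := le_trans r0 rx; have xt := le_trans xs st.
have -> : v x - c * w x = w x * (expR (primitive w x) - c) by rewrite /v; ring.
rewrite normrM ler_pM// ?wB ?x0//.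
rewrite (le_trans (dist_expR _ _))// ler_pM ?Wrs//.
by rewrite lerD// WE.
Qed.

End primitive.

Lemma primitive_expR (R : realType) (c t : R) : 0 <= c -> 0 <= t ->
  primitive (fun s => c * expR (c * s)) t = expR (c * t) - 1.
Proof.
move=> c0 t0.
have pc s : 0 <= s -> primitive (cst c) s = c * s.
  move=> s0; rewrite /primitive Rintegral_cst//= lebesgue_measure_itv/= lte_fin.
  by move: s0; rewrite le_eqVlt => /predU1P[<-|->]//=; rewrite ?ltxx ?oppr0 ?addr0.
have := @expR_primitive R (cst c) c t t0 (measurable_cst _).
rewrite pc// => ->; last by move=> s _; rewrite ger0_norm.
rewrite addrC addKr; apply: eq_Rintegral => s.
by rewrite inE/= in_itv/= => /andP[s0 _]; rewrite pc.
Qed.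

(** * Geometric convergence and quotients *)

(** Subtracting the remaining geometric tail from u gives a nondecreasing
    sequence. *)
Lemma geometric_increments_cvg (R : realType) (u : nat -> R) (C : R) : 0 <= C ->
  (forall n, `|u n.+1 - u n| <= C * 2^-1 ^+ n) ->
  cvgn u /\ forall n, `|limn u - u n| <= 2 * C * 2^-1 ^+ n.
Proof.
move=> C0 uC; pose q n : R := 2^-1 ^+ n.
have q0 n : 0 <= q n by rewrite exprn_ge0.
have qS n : q n.+1 = q n / 2 by rewrite /q exprSr.
have uD n j : `|u (n + j)%N - u n| <= 2 * C * (q n - q (n + j)%N).
  elim: j => [|j ih]; first by rewrite addn0 !subrr normr0 mulr0.
  rewrite addnS (le_trans (ler_distD (u (n + j)%N) _ _))//.
  apply: le_trans (lerD (uC _) ih) _.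
  by rewrite -/(q _) qS le_eqVlt; apply/orP; left; apply/eqP; field.
have uB n m : (n <= m)%N -> `|u m - u n| <= 2 * C * q n.
  move=> nm; rewrite -(subnKC nm) (le_trans (uD _ _))// ler_wpM2l ?mulr_ge0//.
  by rewrite gerBl.
have cq : (fun n => 2 * C * q n) @ \oo --> (0 : R).
  rewrite -[X in _ --> X](mulr0 (2 * C)); apply: cvgM; first exact: cvg_cst.
  by apply: cvg_expr; rewrite ger0_norm// invf_lt1// ltr1n.
have cv : cvgn (fun n => u n - 2 * C * q n).
  apply: nondecreasing_is_cvgn.
    apply/nondecreasing_seqP => n; have := uC n.
    rewrite -/(q n) qS ler_norml => /andP[H _].
    rewrite -subr_ge0; apply: le_trans (_ : 0 <= u n.+1 - u n + C * q n) _.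
      by rewrite -lerBlDr sub0r.
    by rewrite le_eqVlt; apply/orP; left; apply/eqP; field.
  exists (u 0%N + 2 * C * q 0%N) => _ [n _ <-].
  have := uB 0%N n (leq0n n); rewrite ler_norml => /andP[_].
  rewrite lerBlDl => H; apply: le_trans H.
  by rewrite gerBl !mulr_ge0.
have cu : cvgn u.
  have -> : u = (fun n => u n - 2 * C * q n) \+ (fun n => 2 * C * q n).
    by apply/funext => n /=; rewrite subrK.
  by apply: is_cvgD => //; apply/cvg_ex; exists 0.
split => // n.
have : `|u m - u n| @[m --> \oo] --> `|limn u - u n|.
  by apply: cvg_norm; apply: cvgB => //; exact: cvg_cst.
move=> /cvgr_to_le; apply; exists n => // m /=; exact: uB.
Qed.

(** Dividing by the larger of the two denominators keeps the constant absolute: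
    a + b is then at most twice the denominator. *)
Lemma dist_ratio (R : realFieldType) (a b A B e : R) :
  0 < a -> 0 < b -> `|A| <= a -> `|B| <= b ->
  `|a - b| <= e * (a + b) -> `|A - B| <= e * (a + b) ->
  `|A / a - B / b| <= 4 * e.
Proof.
wlog ba : a b A B / b <= a.
  move=> H a0 b0 Aa Bb ab AB; case: (leP b a) => [ba|/ltW ab']; first exact: H.
  rewrite distrC; apply: H => //; rewrite 1?distrC 1?[b + a]addrC//.
move=> a0 b0 Aa Bb ab AB.
have -> : A / a - B / b = (A - B) / a + (B / b) * ((b - a) / a).
  by field; rewrite !gt_eqF.
have e0 : 0 <= e.
  by rewrite -(pmulr_lge0 _ (addr_gt0 a0 b0)) (le_trans (normr_ge0 _) ab).
have eab : e * (a + b) / a <= 2 * e.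
  rewrite ler_pdivrMr//.
  have : 0 <= e * (a - b) by rewrite mulr_ge0// subr_ge0.
  nra.
have -> : 4 * e = 2 * e + 1 * (2 * e) by ring.
rewrite (le_trans (ler_normD _ _))// !normrM !normfV.
rewrite (gtr0_norm a0) (gtr0_norm b0) lerD//.
  by rewrite (le_trans _ eab)// ler_pM2r ?invr_gt0.
rewrite ler_pM ?divr_ge0 ?(ltW a0) ?(ltW b0)//.
  by rewrite ler_pdivrMr// mul1r.
by rewrite (le_trans _ eab)// ler_pM2r ?invr_gt0// distrC.
Qed.

(** * Replicator equations with an antisymmetric kernel *)

Section replicator.
Context d (X : measurableType d) (R : realType).
Variable m : {sigma_finite_measure set X -> \bar R}.
Variables (g : X -> R) (k : X -> X -> R -> R).
Hypothesis ig : m.-integrable setT (EFin \o g).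
Hypothesis g_ge0 : forall x, 0 <= g x.
Hypothesis g_mass : \int[m]_x g x = 1.
Hypothesis mk : measurable_fun setT (fun q : (X * R) * X => k q.1.1 q.2 q.1.2).
Hypothesis k_le1 : forall x y t, `|k x y t| <= 1.
Hypothesis kA : forall x y t, k x y t = - k y x t.

Definition bounded_rate (w : X -> R -> R) :=
  measurable_fun setT (fun p : X * R => w p.1 p.2) /\ forall x t, `|w x t| <= 1.

Definition population (w : X -> R -> R) x t := g x * expR (primitive (w x) t).

Definition mass w t := \int[m]_x population w x t.

(** Normalised by the mass, although the equation to solve is not: see
    [mass_conserved]. *)
Definition payoff w x t :=
  (\int[m]_y (k x y t * population w y t)) / mass w t.

Lemma measurable_g : measurable_fun setT g.
Proof. exact/measurable_EFinP/(measurable_int m ig). Qed.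

Lemma bounded_rate_section w x : bounded_rate w -> measurable_fun setT (w x).
Proof. by case=> mw _; exact: (measurableT_comp mw (pair1_measurable x)). Qed.

Lemma norm_primitive_rate w x t : bounded_rate w ->
  `|primitive (w x) t| <= `|t|.
Proof.
move=> bw; case: (leP t 0) => [/primitive0 ->|/ltW t0]; first by rewrite normr0.
rewrite -[leRHS]mul1r (ger0_norm t0); apply: norm_primitive => //.
  exact: bounded_rate_section.
by move=> r _; case: bw.
Qed.

Lemma population_ge0 w x t : 0 <= population w x t.
Proof. by rewrite mulr_ge0 ?expR_ge0. Qed.

Lemma population_le w x t : bounded_rate w ->
  population w x t <= expR `|t| * g x.
Proof.
move=> bw; rewrite /population mulrC ler_wpM2r// ler_expR.
exact: le_trans (ler_norm _) (norm_primitive_rate x t bw).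
Qed.

Lemma population_ge w x t : bounded_rate w ->
  expR (- `|t|) * g x <= population w x t.
Proof.
move=> bw; rewrite /population [leRHS]mulrC ler_wpM2r// ler_expR lerNl.
by rewrite (le_trans _ (norm_primitive_rate x t bw))// -normrN ler_norm.
Qed.

Lemma measurable_population w : bounded_rate w ->
  measurable_fun setT (fun p : X * R => population w p.1 p.2).
Proof.
case=> mw _; apply: measurable_funM.
  exact: (measurableT_comp measurable_g measurable_fst).
exact: (measurableT_comp (@measurable_expR R) (measurable_primitive mw)).
Qed.

Lemma measurable_population1 w t : bounded_rate w ->
  measurable_fun setT (population w ^~ t).
Proof.
move=> bw.
exact: (measurableT_comp (measurable_population bw) (pair2_measurable t)).
Qed.

Lemma integrable_population w t : bounded_rate w ->
  m.-integrable setT (EFin \o population w ^~ t).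
Proof.
move=> bw; apply: (@integrable_le _ _ _ _ _ _ (fun x => expR `|t| * g x)) => //.
- exact: measurable_population1.
- exact: (integrableZl measurableT _ ig).
- by move=> x _; rewrite ger0_norm ?population_ge0// population_le.
Qed.

Lemma mass_gt0 w t : bounded_rate w -> 0 < mass w t.
Proof.
move=> bw; apply: (@lt_le_trans _ _ (expR (- `|t|) * 1)).
  by rewrite mulr1 expR_gt0.
rewrite -g_mass -RintegralZl//; apply: le_Rintegral => //.
- exact: (integrableZl measurableT _ ig).
- exact: integrable_population.
- by move=> x _; exact: population_ge.
Qed.

Lemma measurable_k1 x t : measurable_fun setT (fun y => k x y t).
Proof. exact: (measurableT_comp mk (pair1_measurable (x, t))). Qed.

Lemma integrable_k_population w x t : bounded_rate w ->
  m.-integrable setT (EFin \o (fun y => k x y t * population w y t)).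
Proof.
move=> bw; apply: (@integrable_le _ _ _ _ _ _ (population w ^~ t)) => //.
- by apply: measurable_funM; [exact: measurable_k1|exact: measurable_population1].
- exact: integrable_population.
- move=> y _; rewrite normrM (ger0_norm (population_ge0 _ _ _)).
  by rewrite ler_piMl ?population_ge0.
Qed.

Lemma norm_payoff_num w x t : bounded_rate w ->
  `|\int[m]_y (k x y t * population w y t)| <= mass w t.
Proof.
move=> bw; have ikp := integrable_k_population x t bw.
rewrite (le_trans (le_normr_Rintegral _ ikp))//; apply: le_Rintegral => //.
- exact: integrable_norm.
- exact: integrable_population.
- move=> y _; rewrite normrM (ger0_norm (population_ge0 _ _ _)).
  by rewrite ler_piMl ?population_ge0.
Qed.

Lemma bounded_rate_payoff w : bounded_rate w -> bounded_rate (payoff w).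
Proof.
move=> bw; split; last first.
  move=> x t; have M0 := mass_gt0 t bw.
  rewrite normrM normfV (gtr0_norm M0) ler_pdivrMr// mul1r.
  exact: norm_payoff_num.
(* The inverse of the mass as exp (- ln mass), a composition of measurable
   functions. *)
have -> : (fun p : X * R => payoff w p.1 p.2) = fun p : X * R =>
    (\int[m]_y (k p.1 y p.2 * population w y p.2)) * expR (- ln (mass w p.2)).
  by apply/funext => p; rewrite expRN lnK// posrE mass_gt0.
apply: measurable_funM.
  apply: (@measurable_param_Rintegral _ _ (X * measurableTypeR R)%type X R m
    (fun p y => k p.1 y p.2 * population w y p.2)).
  apply: measurable_funM => //.
  apply: (measurableT_comp (measurable_population bw)
    (g := fun q : (X * R) * X => (q.2, q.1.2))).
  apply: measurable_fun_pair; first exact: measurable_snd.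
  exact: (measurableT_comp measurable_snd measurable_fst).
apply: (measurableT_comp (@measurable_expR R)); apply: measurable_funN.
apply: (measurableT_comp (@measurable_ln R)).
apply: (@measurableT_comp _ _ _ _ _ _ (mass w) _ snd) => //.
apply: (@measurable_param_Rintegral _ _ (measurableTypeR R) X R m
    (fun t y => population w y t)).
exact: (measurableT_comp (measurable_population bw)
    (measurable_fun_pair measurable_snd measurable_fst)).
Qed.

(** If w and v differ by e exp (8 |t|), their primitives differ by at most
    dl = e exp (8 |t|) / 8. Numerator and denominator of the payoff then change
    by at most dl times the sum of the two masses, since
    |exp a - exp b| <= |a - b| (exp a + exp b), and the quotient by at most
    4 dl, whatever the size of the masses. The exponent 8 makes 4 dl one half
    of the initial distance. *)
Lemma payoff_contraction w v e : bounded_rate w -> bounded_rate v -> 0 <= e ->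
  (forall x t, `|w x t - v x t| <= e * expR (8 * `|t|)) ->
  forall x t, `|payoff w x t - payoff v x t| <= e / 2 * expR (8 * `|t|).
Proof.
move=> bw bv e0 wv x t; pose dl := e / 8 * expR (8 * `|t|).
have Wdl y : `|primitive (w y) t - primitive (v y) t| <= dl.
  case: (leP t 0) => [t0|/ltW t0].
    by rewrite !primitive0// subrr normr0 mulr_ge0 ?expR_ge0 ?divr_ge0.
  have mwy := bounded_rate_section y bw; have mvy := bounded_rate_section y bv.
  have iw : mu.-integrable `[0, t] (EFin \o w y).
    by apply: (@integrable_bounded_itv _ _ 1 0 t) => // s _; case: bw.
  have iv : mu.-integrable `[0, t] (EFin \o v y).
    by apply: (@integrable_bounded_itv _ _ 1 0 t) => // s _; case: bv.
  have ie : mu.-integrable `[0, t] (EFin \o (fun s => 8 * expR (8 * s))).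
    apply: (@integrable_bounded_itv _ _ (8 * expR (8 * t)) 0 t) => //.
      apply: measurable_funM; first exact: measurable_cst.
      apply: (measurableT_comp (@measurable_expR R)).
      by apply: measurable_funM; [exact: measurable_cst|exact: measurable_id].
    move=> s /andP[s0 st]; rewrite ger0_norm ?mulr_ge0 ?expR_ge0//.
    by rewrite ler_pM2l// ler_expR ler_pM2l.
  have iwv : mu.-integrable `[0, t] (EFin \o (fun s => w y s - v y s)).
    exact: (integrableB _ iw iv).
  rewrite /primitive -RintegralB//.
  rewrite (le_trans (le_normr_Rintegral _ iwv))//.
  apply: (@le_trans _ _ (\int[mu]_(s in `[0, t]) (e / 8 * (8 * expR (8 * s))))).
    apply: le_Rintegral => //.
    - exact: integrable_norm.
    - exact: (integrableZl _ _ ie).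
    - move=> s /=; rewrite in_itv/= => /andP[s0 _].
      by rewrite (le_trans (wv y s))// ger0_norm// mulrA divfK.
  rewrite RintegralZl// -/(primitive _ _) primitive_expR//.
  by rewrite ler_wpM2l ?divr_ge0// (ger0_norm t0) gerBl.
have dP y : `|population w y t - population v y t| <=
    dl * (population w y t + population v y t).
  rewrite /population -mulrBr normrM ger0_norm// -mulrDr mulrCA ler_wpM2l//.
  rewrite (le_trans (dist_expR _ _))// ler_wpM2r ?addr_ge0 ?expR_ge0//.
have ipw := integrable_population t bw; have ipv := integrable_population t bv.
have iD : m.-integrable setT
    (EFin \o (fun y => dl * (population w y t + population v y t))).
  exact: (integrableZl measurableT _ (integrableD measurableT ipw ipv)).
have intD : \int[m]_y (dl * (population w y t + population v y t)) =
    dl * (mass w t + mass v t).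
  rewrite RintegralZl// ?RintegralD//.
  exact: (integrableD measurableT ipw ipv).
have -> : e / 2 * expR (8 * `|t|) = 4 * dl by rewrite /dl; field.
apply: dist_ratio; rewrite ?mass_gt0 ?norm_payoff_num//.
  have i : m.-integrable setT
      (EFin \o (fun y => population w y t - population v y t)).
    exact: (integrableB measurableT ipw ipv).
  rewrite /mass -RintegralB// (le_trans (le_normr_Rintegral _ i))// -intD.
  by apply: le_Rintegral => //; exact: integrable_norm.
have ikw := integrable_k_population x t bw.
have ikv := integrable_k_population x t bv.
have i : m.-integrable setT
    (EFin \o (fun y => k x y t * population w y t - k x y t * population v y t)).
  exact: (integrableB measurableT ikw ikv).
rewrite -RintegralB// (le_trans (le_normr_Rintegral _ i))// -intD.
apply: le_Rintegral => //; first exact: integrable_norm.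
move=> y _; rewrite -mulrBr normrM (le_trans _ (dP y))//.
by rewrite ler_piMl.
Qed.

(** Picard iteration from the zero rate. The weighted distance of successive
    iterates is at most 2 ^ (- n); the limit is a fixed point because the
    contraction estimate also compares it with the iterates. *)
Lemma payoff_fixpoint :
  exists2 w, bounded_rate w & forall x t, payoff w x t = w x t.
Proof.
pose u n := iter n payoff (fun _ _ => 0).
have bu n : bounded_rate (u n).
  elim: n => [|n ih]; last exact: (bounded_rate_payoff ih).
  by split => [|x t]; [exact: measurable_cst|rewrite normr0].
pose G (t : R) := expR (8 * `|t|).
have G0 t : 0 <= G t by exact: expR_ge0.
have uS n x t : `|u n.+1 x t - u n x t| <= G t * 2^-1 ^+ n.
  rewrite mulrC; elim: n x t => [x t|n ih x t].
    rewrite subr0 expr0 mul1r (le_trans (proj2 (bu 1%N) x t))//.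
    by rewrite -expR0 ler_expR mulr_ge0.
  rewrite exprSr.
  by apply: (payoff_contraction (bu n.+1) (bu n) _ ih); rewrite exprn_ge0.
pose w x t := limn (fun n => u n x t).
have ucvg x t : cvgn (fun n => u n x t).
  by have [] := geometric_increments_cvg (G0 t) (fun n => uS n x t).
have wu n x t : `|w x t - u n x t| <= 2 * 2^-1 ^+ n * G t.
  have [_] := geometric_increments_cvg (G0 t) (fun n => uS n x t).
  by move=> /(_ n); rewrite mulrAC.
have bw : bounded_rate w.
  split.
    apply: (@measurable_fun_cvg _ _ _ _ (fun n (p : X * R) => u n p.1 p.2)).
    - by move=> n; exact: (bu n).1.
    - by move=> p _; exact: ucvg.
  move=> x t; have /cvg_norm /cvgr_to_le := ucvg x t; apply.
  by exists 0%N => // n _ /=; exact: (bu n).2.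
exists w => // x t.
have bnd n : `|payoff w x t - w x t| <= 3 * G t * 2^-1 ^+ n.
  have h1 : `|payoff w x t - u n.+1 x t| <= _ :=
    payoff_contraction bw (bu n) (mulr_ge0 (ler0n _ _) (exprn_ge0 _ _)) (wu n) x t.
  have h2 := wu n.+1 x t; rewrite distrC in h2.
  rewrite (le_trans (ler_distD (u n.+1 x t) _ _))//.
  apply: le_trans (lerD (h1 _) h2) _; first by [].
  rewrite exprSr -/(G t) -subr_ge0.
  set p := _ ^+ _; have p0 : 0 <= p by rewrite exprn_ge0.
  rewrite [leRHS](_ : _ = G t * p); first by rewrite mulr_ge0.
  by field.
apply/eqP; rewrite -subr_eq0 -normr_le0.
have : (fun n => 3 * G t * 2^-1 ^+ n) @ \oo --> (0 : R).
  rewrite -[X in _ --> X](mulr0 (3 * G t)); apply: cvgM; first exact: cvg_cst.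
  by apply: cvg_expr; rewrite ger0_norm// invf_lt1// ltr1n.
by move=> /cvgr_to_ge; apply; exists 0%N => // n _ /=; exact: bnd.
Qed.

Lemma integrable_population_rate w v t : bounded_rate w -> bounded_rate v ->
  m.-integrable setT (EFin \o (fun x => population w x t * v x t)).
Proof.
move=> bw [mv v1]; apply: (@integrable_le _ _ _ _ _ _ (population w ^~ t)) => //.
- apply: measurable_funM; first exact: measurable_population1.
  exact: (measurableT_comp mv (pair2_measurable t)).
- exact: integrable_population.
- move=> x _; rewrite normrM (ger0_norm (population_ge0 _ _ _)).
  by rewrite ler_piMr ?population_ge0.
Qed.

(** The double integral of an antisymmetric function is its own opposite. *)
Lemma mean_payoff0 w t : bounded_rate w ->
  \int[m]_x (population w x t * payoff w x t) = 0.
Proof.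
move=> bw; pose p := population w ^~ t.
have p0 x : 0 <= p x by exact: population_ge0.
have ip : m.-integrable setT (EFin \o p) by exact: integrable_population.
have M0 := mass_gt0 t bw.
pose c := (mass w t)^-1; have c0 : 0 <= c by rewrite invr_ge0 ltW.
pose h x y := c * p x * (k x y t * p y).
have hE x : \int[m]_y h x y = p x * payoff w x t.
  rewrite RintegralZl//; last exact: integrable_k_population.
  by rewrite /payoff -/c; ring.
have hA x y : h x y = -1 * h y x by rewrite /h kA; ring.
have mh : measurable_fun setT (fun q : X * X => h q.1 q.2).
  have mp := measurable_population1 t bw.
  apply: measurable_funM.
    apply: measurable_funM; first exact: measurable_cst.
    exact: (measurableT_comp mp measurable_fst).
  apply: measurable_funM; last exact: (measurableT_comp mp measurable_snd).
  apply: (@measurableT_comp _ _ _ _ _ _ _ _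
    (fun q : X * X => (q.1, t, q.2) : (X * measurableTypeR R) * X)%type mk).
  apply: measurable_fun_pair; last exact: measurable_snd.
  by apply: measurable_fun_pair; [exact: measurable_fst|exact: measurable_cst].
have ih x : m.-integrable setT (EFin \o h x).
  exact: (integrableZl measurableT _ (integrable_k_population x t bw)).
have swap : \int[m]_x \int[m]_y h x y = \int[m]_y \int[m]_x h x y.
  apply: (@Rintegral_swap _ _ _ _ _ _ _ h (fun x => c * p x) p) => //.
    exact: (integrableZl measurableT c ip).
  move=> x y; rewrite /h (normrM (c * p x)) (normrM (k x y t)) (ger0_norm (p0 y)).
  by rewrite (ger0_norm (mulr_ge0 c0 (p0 x))) ler_wpM2l ?mulr_ge0// ler_piMl.
have anti : \int[m]_y \int[m]_x h x y = -1 * \int[m]_y \int[m]_x h y x.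
  have iJ : m.-integrable setT (EFin \o (fun y => \int[m]_x h y x)).
    rewrite (_ : (fun y => _) = (fun y => p y * payoff w y t)).
      exact: (integrable_population_rate t bw (bounded_rate_payoff bw)).
    by apply/funext => y; exact: hE.
  rewrite -(RintegralZl (-1) measurableT iJ).
  apply: eq_Rintegral => y _; rewrite -(RintegralZl (-1) measurableT (ih y)).
  by apply: eq_Rintegral => x _; exact: hA.
have self0 (I : R) : I = -1 * I -> I = 0.
  by rewrite mulN1r => /eqP; rewrite -addr_eq0 -mulr2n mulrn_eq0 => /eqP.
rewrite -[RHS](self0 _ (etrans swap anti)).
by apply: eq_Rintegral => x _; rewrite hE.
Qed.

Lemma population_growth w x t : bounded_rate w -> 0 <= t ->
  population w x t = g x + primitive (fun s => population w x s * w x s) t.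
Proof.
move=> bw t0; have mwx := bounded_rate_section x bw.
have wx1 s : 0 <= s <= t -> `|w x s| <= 1 by move=> _; case: bw.
rewrite /population (expR_primitive t0 mwx wx1) mulrDr mulr1; congr (_ + _).
rewrite /primitive -RintegralZl//.
  by apply: eq_Rintegral => s _; rewrite -/(primitive _ _); ring.
apply: (@integrable_bounded_itv _ _ (expR t) 0 t) => //.
  apply: measurable_funM => //.
  by apply: (measurableT_comp (@measurable_expR R)); exact: measurable_primitive1.
move=> s /andP[s0 st]; rewrite normrM (ger0_norm (expR_ge0 _)) -[leRHS]mul1r.
rewrite ler_pM ?expR_ge0 ?wx1 ?s0// ler_expR (le_trans (ler_norm _))//.
by rewrite (le_trans (norm_primitive_rate x s bw))// ger0_norm.
Qed.

(** The increment of the mass is the integral in x and then in time of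
    population times rate; in the other order of integration the inner integral
    is zero by [mean_payoff0]. *)
Lemma mass_conserved w t : bounded_rate w -> 0 <= t ->
  (forall x s, payoff w x s = w x s) -> mass w t = 1.
Proof.
move=> bw t0 fix_w; have ip := integrable_population t bw.
pose h x s := if (0 <= s) && (s <= t) then population w x s * w x s else 0.
have hE x : \int[mu]_s h x s = population w x t - g x.
  rewrite (population_growth x bw t0) addrC addKr /primitive [RHS]Rintegral_mkcond.
  by apply: eq_Rintegral => s _; rewrite patchE mem_setE in_itv.
apply/eqP; rewrite -subr_eq0 -g_mass -RintegralB//; apply/eqP.
under eq_Rintegral do rewrite -hE.
have mh : measurable_fun setT
    (fun q : X * measurableTypeR R => h q.1 q.2).
  apply: measurable_fun_ifT => //=.
  - by apply: measurable_and; apply: measurable_fun_ler;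
      [exact: measurable_cst|exact: measurable_snd|
       exact: measurable_snd|exact: measurable_cst].
  - by apply: measurable_funM; [exact: measurable_population|case: bw].
pose b s : R := expR t * \1_`[0, t] s.
have ib : mu.-integrable setT (EFin \o b).
  exact: (integrableZl measurableT _ (integrable_indic_itv 0 t true false)).
rewrite (@Rintegral_swap _ _ X (measurableTypeR R) R m (@lebesgue_measure R) h g b)//.
  transitivity (\int[mu]_(s in setT) (0 : R)); last by rewrite Rintegral_cst// mul0r.
  apply: eq_Rintegral.
  move=> s _; rewrite /h; case: (_ && _); last by rewrite Rintegral_cst// mul0r.
  rewrite -[RHS](mean_payoff0 s bw).
  by apply: eq_Rintegral => x _; rewrite fix_w.
move=> x s; rewrite /h /b indicE mem_setE in_itv /=.
case: ifP => [/andP[s0 st]|_]; last by rewrite normr0 !mulr0.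
rewrite mulr1.
rewrite normrM (ger0_norm (population_ge0 _ _ _)) -[leRHS]mulr1.
rewrite ler_pM ?population_ge0//.
  rewrite (le_trans (population_le x s bw))// mulrC ler_wpM2l// ler_expR ger0_norm//.
by case: bw.
Qed.

(** The mass being 1, the normalised fixed point is a genuine solution, in the
    time-integrated sense and for every trait x. *)
Theorem replicator_equation : exists2 w, bounded_rate w &
  forall x t, 0 <= t ->
    w x t = \int[m]_y (k x y t * population w y t) /\
    population w x t =
      g x + primitive (fun s => population w x s * w x s) t.
Proof.
have [w bw fix_w] := payoff_fixpoint.
exists w => // x t t0; split; last exact: population_growth.
by rewrite -[LHS]fix_w /payoff mass_conserved// divr1.
Qed.

End replicator.

(** * Membership in the Bochner space *)

(** On each cell of a uniform partition of [[0, T[ the function is frozen at the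
    left end point; the error is at most the mesh size times the L^1 norm of G. The
    end point T belongs to no cell, but it is negligible. *)
Lemma lipschitz_strongly_measurable_L1 (R : realType) (I : set R) (T : R)
    (f : R -> R -> R) (G : R -> R) :
  measurable I -> 0 < T ->
  (forall t, 0 <= t <= T -> in_Lp 1%E I (f^~ t)) ->
  mu.-integrable setT (EFin \o G) ->
  (forall z s t, 0 <= s -> s <= t -> t <= T ->
    `|f z t - f z s| <= (t - s) * G z) ->
  strongly_measurable_L1 I `[0, T] f.
Proof.
move=> mI T0 fI iG fG.
pose x n (i : nat) : R := T * i%:R / n.+1%:R.
have x_ge0 n i : 0 <= x n i by rewrite divr_ge0// mulr_ge0// ltW.
have xS n i : x n i.+1 = x n i + T / n.+1%:R.
  by rewrite /x -[i.+1]addn1 natrD mulrDr mulrDl mulr1.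
have xT n i : (i <= n.+1)%N -> x n i <= T.
  by move=> iN; rewrite /x ler_pdivrMr// ler_pM2l// ler_nat.
pose A n (i : 'I_n.+1) : set R := `[x n i, x n i.+1[%classic.
pose s n z t := \sum_(i < n.+1) \1_(A n i) t * f z (x n i).
exists s; split.
  move=> n; exists n.+1, (A n), (fun i z => f z (x n i)); split => // i.
    split; first exact: measurable_itv.
    move=> t /=; rewrite !in_itv/= => /andP[xt tx].
    rewrite (le_trans (x_ge0 n i) xt)/= (le_trans (ltW tx))// xT//.
  by apply: fI; rewrite x_ge0 xT// ltnW.
have sE n t : 0 <= t < T ->
    exists2 r, [/\ 0 <= r, r <= t & t - r <= T / n.+1%:R] & forall z, s n z t = f z r.
  move=> /andP[t0 tT]; pose j := Num.truncn (t * n.+1%:R / T).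
  have a0 : 0 <= t * n.+1%:R / T by rewrite divr_ge0// ?mulr_ge0// ltW.
  have /andP[jle ltj] := truncn_itv a0.
  have jn : (j < n.+1)%N.
    by rewrite -(ltr_nat R) (le_lt_trans jle)// ltr_pdivrMr// [ltRHS]mulrC ltr_pM2r.
  have xj : x n j <= t.
    by rewrite /x ler_pdivrMr// mulrC -ler_pdivlMr.
  have tx : t < x n j.+1.
    by rewrite /x ltr_pdivlMr// [ltRHS]mulrC -ltr_pdivrMr.
  exists (x n j); first by split => //; rewrite lerBlDl -xS ltW.
  move=> z; rewrite /s (bigD1 (Ordinal jn))//= indicE mem_set ?mul1r; last first.
    by rewrite /A /= in_itv/= xj tx.
  rewrite big1 ?addr0// => i ij; rewrite indicE memNset ?mul0r// /A /= in_itv/=.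
  move=> /andP[xit txi]; move/negP: ij; apply; apply/eqP/val_inj => /=.
  have xle a b : x n a < x n b -> (a < b)%N.
    by rewrite /x ltr_pM2r ?invr_gt0// ltr_pM2l// ltr_nat.
  apply/eqP; rewrite eqn_leq; apply/andP; split; rewrite -ltnS; apply: xle.
    exact: le_lt_trans xit tx.
  exact: le_lt_trans xj txi.
exists [set T]; split => //; first by rewrite lebesgue_measure_set1.
move=> t /= /not_implyP[tJ ncv]; apply: contrapT => tT; apply: ncv.
have {tJ}tJ : 0 <= t < T.
  move: tJ; rewrite in_itv/= => /andP[-> tleT].
  by rewrite lt_neqAle tleT andbT; apply/eqP.
have [t0 ltT] := andP tJ.
have mf r : 0 <= r <= T -> measurable_fun I (f^~ r).
  move=> /fI rI; apply/measurable_restrictT => //.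
  exact: (set_mem (sub_Lfun_mfun rI)).
have iGn := integrable_norm iG.
pose c := \int[mu]_z `|G z|.
have bnd n : (norm_Lp 1 I (fun z => f z t - s n z t)%R <= (T * c * n.+1%:R^-1)%:E)%E.
  have [r [r0 rt tr] sr] := sE n t tJ.
  rewrite /norm_Lp Lnorm1 (_ : T * c * n.+1%:R^-1 = T / n.+1%:R * c); last by ring.
  have ig' : mu.-integrable setT (EFin \o (fun z => T / n.+1%:R * `|G z|)).
    exact: (integrableZl measurableT _ iGn).
  have cE : (T / n.+1%:R * c)%:E = (\int[mu]_z (T / n.+1%:R * `|G z|)%:E)%E.
    rewrite -RintegralZl// /Rintegral fineK//.
    exact: (integrable_fin_num measurableT ig').
  rewrite cE; apply: ge0_le_integral => //.
  - apply: measurableT_comp => //; apply/measurable_EFinP.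
    apply/(measurable_restrictT _ mI).
    rewrite (_ : (fun z => f z t - s n z t) = (fun z => f z t - f z r)); last first.
      by apply/funext => z; rewrite sr.
    by apply: measurable_funB; apply: mf; rewrite ?r0 ?t0 ltW// (le_lt_trans rt).
  - exact: (measurable_int _ ig').
  - move=> z _; rewrite /= lee_fin patchE; case: ifP => _; last first.
      by rewrite normr0 mulr_ge0// divr_ge0// ltW.
    rewrite sr (le_trans (fG z r t r0 rt (ltW ltT)))//.
    rewrite (le_trans (ler_norm _))// normrM ler_wpM2r// ger0_norm// subr_ge0//.
apply: (@squeeze_cvge _ _ _ _ (cst 0%E) _ (fun n => (T * c * n.+1%:R^-1)%:E)).
- by apply: nearW => n; rewrite Lnorm_ge0 bnd.
- exact: cvg_cst.
- apply: cvg_EFin; first exact: nearW.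
  rewrite -(mulr0 (T * c)); apply: cvgM; first exact: cvg_cst.
  exact: cvg_harmonic.
Qed.

(** The growth rate is at most 1, so on [[0, T]] the population is at most
    exp T times g, and it is Lipschitz in time with that same factor. *)
Lemma population_Linfty_L1 (R : realType) (I : set R) (g : R -> R)
    (w : R -> R -> R) (T : R) : measurable I -> 0 < T ->
  (forall z, 0 <= g z) -> mu.-integrable setT (EFin \o g) -> bounded_rate w ->
  Linfty_L1 I `[0, T] (population g w).
Proof.
move=> mI T0 g0 ig bw.
have mp := measurable_population ig bw.
have ip t := integrable_population ig g0 t bw.
have mpt t : measurable_fun setT ((population g w)^~ t).
  exact: (measurable_population1 ig t bw).
have inL t : in_Lp 1%E I ((population g w)^~ t).
  apply/Lfun1_integrable.
  refine (@integrable_le _ _ _ (@lebesgue_measure R) setT _ ((population g w)^~ t)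
    measurableT _ (ip t) _).
    by apply/(measurable_restrictT _ mI); exact: measurable_funTS.
  move=> z _; rewrite patchE; case: ifP => _.
    by rewrite ger0_norm// population_ge0.
  by rewrite normr0 population_ge0.
split.
- exact: measurable_funTS.
- by apply: aeW => t _; exact: inL.
- apply: (@lipschitz_strongly_measurable_L1 _ I T _ (fun z => expR T * g z)) => //.
    exact: (integrableZl measurableT _ ig).
  move=> z s t s0 st tT; have t0 := le_trans s0 st.
  rewrite !(@population_growth _ R R g w z)// opprD addrACA subrr add0r mulrC.
  apply: primitive_lipschitz => //.
    apply: measurable_funM; last exact: bounded_rate_section.
    exact: (measurableT_comp mp (pair1_measurable z)).
  move=> r /andP[r0 rt]; rewrite normrM -[leRHS]mulr1 ler_pM//; last by case: bw.
  rewrite ger0_norm ?population_ge0// (le_trans (population_le g0 z r bw))//.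
  by rewrite ler_wpM2r// ler_expR ger0_norm// (le_trans rt).
- rewrite unlock; case: ifPn => _; last exact: ltry.
  pose c := \int[mu]_z g z.
  apply: (@le_lt_trans _ _ (expR T * c)%:E); last exact: ltry.
  apply/ess_supP; apply: aeW => t /=; rewrite patchE.
  case: ifPn => [tJ|_]; last first.
    by rewrite abse0 lee_fin mulr_ge0 ?expR_ge0// Rintegral_ge0.
  rewrite /norm_Lp Lnorm1 gee0_abs; last exact: integral_ge0.
  have iTg : mu.-integrable setT (EFin \o (fun z => expR T * g z)).
    exact: (integrableZl measurableT _ ig).
  have -> : (expR T * c)%:E = (\int[mu]_z (expR T * g z)%:E)%E.
    rewrite -RintegralZl// /Rintegral fineK//.
    exact: (integrable_fin_num measurableT iTg).
  apply: ge0_le_integral => //.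
  + apply: measurableT_comp => //; apply/measurable_EFinP.
    by apply/(measurable_restrictT _ mI); exact: measurable_funTS.
  + exact: (measurable_int _ iTg).
  + move: tJ; rewrite mem_setE in_itv/= => /andP[t0 tT] z _.
    rewrite /= lee_fin patchE; case: ifP => _; last first.
      by rewrite normr0 mulr_ge0 ?expR_ge0.
    rewrite ger0_norm ?population_ge0// (le_trans (population_le g0 z t bw))//.
    by rewrite ler_wpM2r// ler_expR ger0_norm.
Qed.

(** * The learning equation as a replicator equation *)

Section learning_kernel.
Context {R : realType}.
Implicit Types (a f : R -> R -> R) (zbar x y z t : R).

(** A trait x gains from the traits below it, at the rate at which they learn,
    and loses its own learners to the traits above it. On the diagonal the two
    terms cancel, which allows closed intervals in both. *)
Definition learning_kernel a x y t : R :=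
  (if y <= x then a y t else 0) - (if x <= y then a x t else 0).

Lemma learning_kernelC a x y t : learning_kernel a x y t = - learning_kernel a y x t.
Proof. by rewrite /learning_kernel opprB. Qed.

Lemma norm_learning_kernel a x y t : (forall z s, 0 <= a z s <= 1) ->
  `|learning_kernel a x y t| <= 1.
Proof.
move=> a01; rewrite /learning_kernel.
have /andP[ax0 ax1] := a01 x t; have /andP[ay0 ay1] := a01 y t.
by rewrite ler_norml; case: ifP => _; case: ifP => _; apply/andP; split; lra.
Qed.

Lemma measurable_learning_kernel a :
  measurable_fun setT (fun p : R * R => a p.1 p.2) ->
  measurable_fun setT (fun q : (R * R) * R => learning_kernel a q.1.1 q.2 q.1.2).
Proof.
move=> ma.
have m1 : measurable_fun setT (fun q : (R * R) * R => q.1.1).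
  exact: (measurableT_comp measurable_fst measurable_fst).
have m2 : measurable_fun setT (fun q : (R * R) * R => q.1.2).
  exact: (measurableT_comp measurable_snd measurable_fst).
have m3 : measurable_fun setT (fun q : (R * R) * R => q.2) by exact: measurable_snd.
apply: measurable_funB; apply: measurable_fun_ifT.
- exact: (measurable_fun_ler m3 m1).
- exact: (measurableT_comp ma (measurable_fun_pair m3 m2)).
- exact: measurable_cst.
- exact: (measurable_fun_ler m1 m3).
- exact: (measurableT_comp ma (measurable_fun_pair m1 m2)).
- exact: measurable_cst.
Qed.

(** Since f vanishes outside [[0, zbar]], both half-interval integrals of the
    right-hand side are integrals over the line of one half of the kernel. *)
Lemma rhs_learning_kernel zbar a f z t :
  measurable_fun setT (a^~ t) -> (forall y, 0 <= a y t <= 1) ->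
  mu.-integrable setT (EFin \o f^~ t) ->
  (forall y, ~~ (0 <= y <= zbar) -> f y t = 0) ->
  rhs zbar a f z t = f z t * \int[mu]_y (learning_kernel a z y t * f y t).
Proof.
move=> ma a01 if_ f0.
have mf : measurable_fun setT (f^~ t).
  by apply/measurable_EFinP; exact: (measurable_int _ if_).
pose A (y : R) : R := (if y <= z then a y t else 0) * f y t.
pose B (y : R) : R := (if z <= y then f y t else 0).
have mA : measurable_fun setT A.
  apply: measurable_funM => //.
  apply: measurable_fun_ifT; [|exact: ma|exact: measurable_cst].
  by apply: measurable_fun_ler; [exact: measurable_id|exact: measurable_cst].
have mB : measurable_fun setT B.
  apply: measurable_fun_ifT; [|exact: mf|exact: measurable_cst].
  by apply: measurable_fun_ler; [exact: measurable_cst|exact: measurable_id].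
have ifn := integrable_norm if_.
have iA : mu.-integrable setT (EFin \o A).
  refine (@integrable_le _ _ _ (@lebesgue_measure R) setT A (fun y => `|f y t|)
    measurableT mA ifn _) => y _; rewrite /A normrM ler_piMl//.
  by have /andP[a0 a1] := a01 y; case: ifP => _; rewrite ?normr0 ?ger0_norm.
have iB : mu.-integrable setT (EFin \o B).
  refine (@integrable_le _ _ _ (@lebesgue_measure R) setT B (fun y => `|f y t|)
    measurableT mB ifn _) => y _; rewrite /B.
  by case: ifP => _//; rewrite normr0.
have -> : \int[mu]_y (learning_kernel a z y t * f y t) =
    \int[mu]_y A y - a z t * \int[mu]_y B y.
  rewrite -RintegralZl// -RintegralB//; last exact: (integrableZl measurableT _ iB).
  apply: eq_Rintegral => y _; rewrite /A /B /learning_kernel mulrBl; congr (_ - _).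
  by case: ifP; rewrite ?mul0r ?mulr0.
have <- : \int[mu]_(y in `[0, z]) (a y t * f y t) = \int[mu]_y A y.
  rewrite Rintegral_mkcond; apply: eq_Rintegral => y _.
  rewrite patchE mem_setE in_itv/= /A.
  case: (leP 0 y) => y0 /=; last by rewrite f0 ?mulr0// leNgt y0.
  by case: ifP => //; rewrite mul0r.
have <- : \int[mu]_(y in `[z, zbar]) f y t = \int[mu]_y B y.
  rewrite Rintegral_mkcond; apply: eq_Rintegral => y _.
  rewrite patchE mem_setE in_itv/= /B andbC.
  case: (leP y zbar) => yz //=; case: ifP => // _.
  by rewrite f0// negb_and -!ltNge yz orbT.
by rewrite /rhs; ring.
Qed.

Lemma measurable_rhs zbar a f z :
  measurable_fun setT (fun p : R * R => a p.1 p.2) ->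
  measurable_fun setT (fun p : R * R => f p.1 p.2) ->
  measurable_fun setT (rhs zbar a f z).
Proof.
move=> ma mf.
have maz : measurable_fun setT (a z) := measurableT_comp ma (pair1_measurable z).
have mfz : measurable_fun setT (f z) := measurableT_comp mf (pair1_measurable z).
have msw : measurable_fun setT (fun p : R * R => (p.2, p.1)).
  exact: (measurable_fun_pair measurable_snd measurable_fst).
have mas : measurable_fun setT (fun p : R * R => a p.2 p.1).
  exact: (measurableT_comp ma msw).
have mfs : measurable_fun setT (fun p : R * R => f p.2 p.1).
  exact: (measurableT_comp mf msw).
apply: measurable_funD.
  apply: measurable_funM.
    by apply: measurable_funM => //; exact: measurable_funN.
  exact: (@measurable_param_Rintegral_in _ _ (measurableTypeR R) (measurableTypeR R)
    R (@lebesgue_measure R) _ (fun t y => f y t)).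
apply: measurable_funM => //.
apply: (@measurable_param_Rintegral_in _ _ (measurableTypeR R) (measurableTypeR R)
    R (@lebesgue_measure R) _ (fun t y => a y t * f y t)) => //.
exact: measurable_funM.
Qed.

End learning_kernel.

Theorem theorem3p2 (R : realType) (zbar T : R) (f0 : R -> R)
    (alpha : R -> R -> R)
    (zbar_gt0 : 0 < zbar) (T_gt0 : 0 < T)
    (f0_Linfty : in_Lp +oo%E `[0, zbar] f0)
    (f0_ge0 : {ae mu, forall z : R, z \in `[0, zbar] -> 0 <= f0 z})
    (f0_mass : (\int[mu]_(z in `[0%R, zbar]) (f0 z)%:E = 1)%E)
    (alpha_Linfty_L1 : Linfty_L1 `[0, zbar] `[0, T] alpha)
    (alpha_01 : {ae (mu \x mu)%E, forall p : R * R,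
       p.1 \in `[0, zbar] -> p.2 \in `[0, T] -> 0 <= alpha p.1 p.2 <= 1}) :
  exists f : R -> R -> R,
    Linfty_L1 `[0, zbar] `[0, T] f /\ is_solution zbar T alpha f0 f.
Proof.
set I : set R := `[0, zbar]%classic; set J : set R := `[0, T]%classic.
have mI : measurable I by exact: measurable_itv.
have mJ : measurable J by exact: measurable_itv.
have mIJ : measurable (I `*` J) by exact: measurableX.
(* Nonnegative everywhere, and equal to f0 almost everywhere on I. *)
pose g z : R := `|(f0 \_ I) z|.
have mf0 : measurable_fun setT (f0 \_ I).
  exact: (set_mem (sub_Lfun_mfun f0_Linfty)).
have g0 x : 0 <= g x by exact: normr_ge0.
have gI z : z \notin I -> g z = 0.
  by move=> zI; rewrite /g /= patchE (negbTE zI) normr0.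
have g_int : (\int[mu]_z (g z)%:E = 1)%E.
  rewrite -f0_mass [RHS]integral_mkcond.
  apply: ae_eq_integral => //.
  - by apply/measurable_EFinP; exact: measurableT_comp.
  - by rewrite restrict_EFin; exact/measurable_EFinP.
  apply: ae_imply f0_ge0 => z f0z _; rewrite /g /= restrict_EFin /= !patchE.
  case: ifPn => [zI|_]; last by rewrite normr0.
  by rewrite ger0_norm// f0z//; exact: (set_mem zI).
have ig : mu.-integrable setT (EFin \o g).
  apply/integrableP; split.
    by apply/measurable_EFinP; exact: measurableT_comp.
  by under eq_integral do rewrite /= normr_id; rewrite g_int ltry.
have g_mass : \int[mu]_z g z = 1 by rewrite /Rintegral g_int.
have malpha : measurable_fun (I `*` J) (fun p : R * R => alpha p.1 p.2).
  by case: alpha_Linfty_L1.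
pose al z t : R := ((fun q : R * R => alpha q.1 q.2) \_ (I `*` J)) (z, t).
have mal : measurable_fun setT (fun p : R * R => al p.1 p.2).
  rewrite (_ : (fun p => _) = (fun q : R * R => alpha q.1 q.2) \_ (I `*` J)).
    exact/(measurable_restrictT _ mIJ).
  by apply/funext => -[].
have alE z t : I z -> J t -> al z t = alpha z t.
  by move=> zI tJ; rewrite /al patchE mem_set.
(* alpha truncated to [0, 1], so that the kernel is bounded everywhere. *)
pose be z t : R := Num.max 0 (Num.min 1 (al z t)).
have be01 z t : 0 <= be z t <= 1.
  by rewrite /be le_max lexx/= ge_max ler01 ge_min lexx.
have mbe : measurable_fun setT (fun p : R * R => be p.1 p.2).
  apply: measurable_maxr; first exact: measurable_cst.
  by apply: measurable_minr; first exact: measurable_cst.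
have mbet t : measurable_fun setT (be^~ t).
  exact: (measurableT_comp mbe (pair2_measurable t)).
have [al_be1 al_be2] : {ae mu, forall z, {ae mu, forall t, al z t = be z t}} /\
    {ae mu, forall t, {ae mu, forall z, al z t = be z t}}.
  apply: (@ae_prod_sections _ _ (measurableTypeR R) (measurableTypeR R)).
  apply: ae_imply alpha_01 => -[z t] /= H; rewrite /be /al patchE.
  case: ifPn => [/set_mem[/= zI tJ]|_]; last by rewrite min_r ?max_l.
  by have /andP[a0 a1] := H zI tJ; rewrite min_r// max_r.
have [w bw solw] := @replicator_equation _ (measurableTypeR R) R
  (@lebesgue_measure R) g (learning_kernel be) ig g0 g_mass
  (measurable_learning_kernel mbe)
  (fun x y t => norm_learning_kernel x y t be01) (learning_kernelC be).
pose f := population g w.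
have fI z t : z \notin I -> f z t = 0 by move=> zI; rewrite /f /population gI// mul0r.
have mf : measurable_fun setT (fun p : R * R => f p.1 p.2).
  exact: (measurable_population ig bw).
have if_ t : mu.-integrable setT (EFin \o f^~ t).
  exact: (integrable_population ig g0 t bw).
exists f; split; first exact: population_Linfty_L1.
have rhs_be z t : 0 <= t -> rhs zbar be f z t = f z t * w z t.
  move=> t0; rewrite (solw z t t0).1; apply: rhs_learning_kernel => //.
  by move=> y yI; apply: fI; rewrite /I mem_setE in_itv.
have rhs_al z t : I z -> J t -> rhs zbar alpha f z t = rhs zbar al f z t.
  move=> zI tJ; rewrite /rhs alE//; congr (_ + _ * _); apply: eq_Rintegral => y.
  rewrite mem_setE in_itv /= => /andP[y0 yz]; rewrite alE//.
  move: zI; rewrite /I /= !in_itv/= => /andP[_ zz]; rewrite y0; exact: le_trans zz.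
(* Almost every time is good for the traits y under the integral, by al_be2;
   for the trait z itself this holds when z is not exceptional. *)
have rhs_ae z : I z -> {ae mu, forall t, al z t = be z t} ->
    {ae mu, forall t, J t -> rhs zbar alpha f z t = f z t * w z t}.
  move=> zI; apply: (ae_imply2 _ al_be2) => t al_be alz tJ.
  have t0 : 0 <= t by move: tJ; rewrite /J /= in_itv/= => /andP[].
  rewrite rhs_al// -rhs_be// /rhs alz; congr (_ + _ * _).
  have mft : measurable_fun setT (f^~ t).
    exact: (measurableT_comp mf (pair2_measurable t)).
  have malt : measurable_fun setT (al^~ t).
    exact: (measurableT_comp mal (pair2_measurable t)).
  apply: (@Rintegral_ae_eq _ (measurableTypeR R) R (@lebesgue_measure R)) => //.
  - by apply: measurable_funTS; exact: measurable_funM.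
  - by apply: measurable_funTS; apply: measurable_funM => //; exact: mbet.
  - by apply: ae_imply al_be => y -> _.
apply: (ae_imply2 _ f0_ge0 al_be1) => z f0z alz zI.
have Iz : I z := zI.
have gz : g z = f0 z by rewrite /g patchE mem_set// ger0_norm// f0z.
have rhsz := rhs_ae z Iz alz.
have mfz : measurable_fun setT (f z) := measurableT_comp mf (pair1_measurable z).
have mwz : measurable_fun setT (w z) := bounded_rate_section z bw.
have mfw : measurable_fun setT (fun t => f z t * w z t) by exact: measurable_funM.
have mrhs : measurable_fun J (rhs zbar alpha f z).
  apply: (eq_measurable_fun (rhs zbar al f z)).
    by move=> t /set_mem tJ; rewrite rhs_al.
  by apply: measurable_funTS; apply: measurable_rhs.
split.
  refine (@integrable_ae_eq _ (measurableTypeR R) R (@lebesgue_measure R)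
    J _ _ mJ mrhs _ rhsz).
  apply: (@integrable_bounded_itv _ _ (expR T * g z) 0 T) => // t /andP[t0 tT].
  rewrite normrM -[leRHS]mulr1 ler_pM//; last by case: bw.
  rewrite ger0_norm ?population_ge0// (le_trans (population_le g0 z t bw))//.
  by rewrite ler_wpM2r// ler_expR ger0_norm.
move=> t; rewrite in_itv/= => /andP[t0 tT].
have -> : f z t = g z + primitive (fun s => f z s * w z s) t := (solw z t t0).2.
rewrite gz; congr (_ + _); apply/esym.
have tJ : `[0, t]%classic `<=` J.
  by move=> s; rewrite /J /= !in_itv/= => /andP[-> st]; exact: le_trans tT.
apply: (@Rintegral_ae_eq _ (measurableTypeR R) R (@lebesgue_measure R)) => //.
- exact: (measurable_funS mJ tJ mrhs).
- exact: measurable_funTS.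
- by apply: ae_imply rhsz => s rs /tJ /rs.
Qed.
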